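(* Let $s>0$ and consider the optimistic rollup game with search costs between the aggregator $A$ and the validator $V$ (described in the context) with $s_A=s_V=s$, $x=\frac{s}{24}$ and $z=24s$, both players being rational and risk neutral. Then there exist values $b,g,h\in[0,1]$ that form a mixed-strategy Nash equilibrium of this game, i.e. $$U_V(b,g,h)\ge U_V(b',g',h)\ \text{ for all } b',g'\in[0,1],\qquad U_A(b,g,h)\ge U_A(b,g,h')\ \text{ for all } h'\in[0,1],$$ and this equilibrium is not the same as the pure-strategy equilibrium of the perfect-information game, in which $A$ behaves honestly with probability $1$ and $V$ (who always knows whether $A$ is honest, i.e. $b=0$) poses no challenge.
   Context: Optimistic rollup game with search costs. Parameters: aggregator stake $s_A>0$, validator stake $s_V>0$, search cost $x>0$, benefit $z>0$ of an undetected dishonest commitment. The payoff of honest behavior for $A$ is normalized to $0$. First $V$ chooses No Search or Search (at cost $x$). Then $A$, not observing this choice, chooses Honest or Dishonest. Then $V$ chooses Challenge or No (no challenge). After No Search, $V$ does not know whether $A$ was honest; after Search, $V$ knows. Payoffs $(A,V)$: After No Search: (Honest, Challenge): $(0,-s_V)$; (Honest, No): $(0,0)$; (Dishonest, Challenge): $(-s_A,\frac12 s_A)$; (Dishonest, No): $(z,0)$. After Search: the same payoffs with $x$ subtracted from $V$'s payoff. After Search, $V$ challenges if and only if $A$ is dishonest. Mixed strategies: $V$ chooses No Search with probability $b$ and, after No Search, challenges with probability $g$; $A$ is honest with probability $h$. The expected utilities are $$U_A(b,g,h)=(1-h)\bigl(b\,(g(-s_A)+(1-g)z)+(1-b)(-s_A)\bigr),$$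 $$U_V(b,g,h)=bg\bigl(h(-s_V)+(1-h)\tfrac12 s_A\bigr)+(1-b)\bigl((1-h)\tfrac12 s_A-x\bigr).$$ Perfect-information game: the version in which $V$ observes $A$'s choice for free; its pure equilibrium has $A$ honest and $V$ not challenging. *)

(* Defs.v *)
From Stdlib Require Import Reals Lra.
Open Scope R_scope.

Record rollup_game := RollupGame {
  stakeA : R;
  stakeV : R;
  search_cost : R;
  benefit : R
}.

Inductive commitment := Honest | Dishonest.
Inductive response := Challenge | NoChallenge.

Definition payoffA (G : rollup_game) (a : commitment) (r : response) : R :=
  match a, r with
  | Honest, _ => 0
  | Dishonest, Challenge => - stakeA G
  | Dishonest, NoChallenge => benefit G
  end.

(** Gross of the search cost, which is subtracted after Search only. *)
Definition payoffV (G : rollup_game) (a : commitment) (r : response) : R :=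
  match a, r with
  | Honest, Challenge => - stakeV G
  | Honest, NoChallenge => 0
  | Dishonest, Challenge => / 2 * stakeA G
  | Dishonest, NoChallenge => 0
  end.

(** After Search the validator is informed and challenges exactly the
    dishonest commitments, so a mixed profile is a triple [(b, g, h)]:
    [b] is the probability of No Search, [g] that of Challenge given No
    Search, [h] that of Honest. *)
Definition informed_response (a : commitment) : response :=
  match a with Honest => NoChallenge | Dishonest => Challenge end.

Definition UA (G : rollup_game) (b g h : R) : R :=
  (1 - h) * (b * (g * (- stakeA G) + (1 - g) * benefit G)
             + (1 - b) * (- stakeA G)).

Definition UV (G : rollup_game) (b g h : R) : R :=
  b * g * (h * (- stakeV G) + (1 - h) * (/ 2 * stakeA G))
  + (1 - b) * ((1 - h) * (/ 2 * stakeA G) - search_cost G).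

(** [UA] and [UV] are the expectations of the payoffs in the game tree. *)
Definition expectation (u : commitment -> response -> R) (b g h : R) : R :=
  b * (h * (g * u Honest Challenge + (1 - g) * u Honest NoChallenge)
       + (1 - h) * (g * u Dishonest Challenge
                    + (1 - g) * u Dishonest NoChallenge))
  + (1 - b) * (h * u Honest (informed_response Honest)
               + (1 - h) * u Dishonest (informed_response Dishonest)).

Lemma UA_expectation (G : rollup_game) (b g h : R) :
  UA G b g h = expectation (payoffA G) b g h.
Proof. unfold UA, expectation; simpl; ring. Qed.

Lemma UV_expectation (G : rollup_game) (b g h : R) :
  UV G b g h = expectation (payoffV G) b g h - (1 - b) * search_cost G.
Proof. unfold UV, expectation; simpl; ring. Qed.

Definition is_prob (p : R) : Prop := 0 <= p <= 1.

Definition mixed_nash (G : rollup_game) (b g h : R) : Prop :=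
  is_prob b /\ is_prob g /\ is_prob h /\
  (forall b' g' : R, is_prob b' -> is_prob g' -> UV G b g h >= UV G b' g' h) /\
  (forall h' : R, is_prob h' -> UA G b g h >= UA G b g h').

(** Pure Nash equilibrium of the perfect-information game, where the
    validator observes the commitment for free and so plays a map [f]. *)
Definition perfect_info_nash (G : rollup_game)
    (a : commitment) (f : commitment -> response) : Prop :=
  (forall a' : commitment, payoffA G a (f a) >= payoffA G a' (f a')) /\
  (forall f' : commitment -> response,
     payoffV G a (f a) >= payoffV G a (f' a)).

Lemma perfect_info_nash_unique (G : rollup_game)
    (a : commitment) (f : commitment -> response) :
  0 < stakeA G -> 0 < stakeV G -> 0 < benefit G ->
  (perfect_info_nash G a f <->
   a = Honest /\ forall a' : commitment, f a' = informed_response a').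
Proof.
intros HA HV Hz; split.
- intros [H1 H2].
  pose proof (H1 Honest) as K1; pose proof (H1 Dishonest) as K2.
  pose proof (H2 informed_response) as K3.
  destruct a; [split; [reflexivity|] |];
    [intros []; simpl in *; destruct (f Honest), (f Dishonest);
       simpl in *; first [reflexivity | lra]
    | destruct (f Honest), (f Dishonest); simpl in *; lra].
- intros [-> Hf]; split.
  + intros []; rewrite !Hf; simpl; lra.
  + intros f'; rewrite Hf; simpl; destruct (f' Honest); lra.
Qed.

Definition challenge_prob (b g h : R) : R := b * g + (1 - b) * (1 - h).

(** The profile of the game with search costs that plays the equilibrium of
    [perfect_info_nash_unique]: the validator is always informed ([b = 0]), the
    aggregator is honest, and no challenge occurs.  [g] is not constrained,
    since it governs a branch that is then never reached. *)
Definition is_perfect_info_profile (b g h : R) : Prop :=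
  h = 1 /\ b = 0 /\ challenge_prob b g h = 0.

(* Main.v *)
Require Import Defs.
From Stdlib Require Import Reals Lra.
Open Scope R_scope.

(** In this equilibrium the validator never challenges uninformed ([g = 0]).
    It is indifferent between No Search and Search when
    [(1 - h) * s / 2 = s / 24], i.e. [h = 11/12], and the aggregator is
    indifferent when [b * (24 * s) = (1 - b) * s], i.e. [b = 1/25].  At
    [h = 11/12] an uninformed challenge has expected value [- 7/8 * s < 0]. *)
Theorem theorem1 (s : R) (hs : 0 < s) :
  let G := {| stakeA := s; stakeV := s; search_cost := s / 24; benefit := 24 * s |} in
  exists b g h : R, mixed_nash G b g h /\ ~ is_perfect_info_profile b g h.
Proof.
intros G; exists (1/25), 0, (11/12); split.
- unfold mixed_nash, is_prob, UA, UV, G; simpl.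
  repeat split; try lra.
  + intros b' g' [Hb _] [Hg _].
    (* At [h = 11/12] the Search term vanishes for every [b'], so the deviation pays
       [- 7/8 * (b' * g' * s)] against [0] in equilibrium. The sign of this cubic monomial is the
       only nonlinear fact that [lra] has to be given. *)
    pose proof (Rmult_le_pos _ _ (Rmult_le_pos _ _ Hb Hg) (Rlt_le _ _ hs)).
    lra.
  (* The factor multiplying [1 - h'] is [24/25 * s - 24/25 * s = 0], so every [h'] yields payoff
     [0]. *)
  + intros h' _; lra.
- intros [Hh _]; lra.
Qed.
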